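(* For $\kappa_\alpha^h\in\mathcal{K}$, $\omega\in\mathbb{R}\setminus\{0\}$ and $\alpha\in\{1,2\}$, the holomorphic extension $e^{-\iota\omega t}u_{\mathbf i,\mathbf j}$ of the fundamental solution $e^{-\iota\omega t}e^{\iota(\kappa_1^hi_1+\kappa_2^hi_2)h}$, $\mathbf i=(i_1,i_2)\in\mathbb{Z}^2$, to the discrete wave equation $\partial_t^2u_{\mathbf i}(t)=\mathcal{L}_hu_{\mathbf i}(t)$, $\mathbf i\in\mathbb{Z}^2$, is discrete holomorphic on $(\Lambda,z^\alpha)$ and still satisfies the discrete wave equation (in the index $\mathbf i$), where $$u_{\mathbf i,\mathbf j}=\prod_{\alpha=1}^2\eta(j_\alpha,\sigma^\alpha,\kappa_\alpha^h,\omega)\,e^{\iota\kappa_\alpha^h(i_\alpha+j_\alpha)h}\quad\text{with}\quad \eta(j_\alpha,\sigma^\alpha,\kappa_\alpha^h,\omega)=\prod_{l=0}^{j_\alpha-1}\frac{2+\iota\frac{\sigma^\alpha_l}{\omega}(1-e^{-\iota\kappa_\alpha^hh})}{2+\iota\frac{\sigma^\alpha_l}{\omega}(1-e^{\iota\kappa_\alpha^hh})}.$$ Moreover, for $\omega\in\mathbb{R}^+$, $\sigma^\alpha>0$ (that is, $\sigma^\alpha_l>0$), $\kappa_\alpha^h\in\mathcal{K}$ and $\mathrm{sgn}(\omega)\Re(\kappa_\alpha^h)>0$, it holds that $$\left|\frac{2+\iota\frac{\sigma^\alpha_l}{\omega}(1-e^{-\iota\kappa_\alpha^hh})}{2+\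iota\frac{\sigma^\alpha_l}{\omega}(1-e^{\iota\kappa_\alpha^hh})}\right|<1.$$
   Context: $\iota$ is the imaginary unit, $h>0$ is the mesh size, and $$\mathcal{K}=\{\kappa\in\mathbb{C}:\ -\tfrac{\pi}{h}<\Re\kappa\le\tfrac{\pi}{h},\ \Im\kappa<0\}.$$ Discrete nonlocal operator. Let $\delta>0$, let $\mathcal{H}_{\mathbf{0}}\subset\mathbb{R}^2$ be the disc of radius $\delta$ centered at $\mathbf 0$, and let $\gamma$ be a nonnegative radial kernel, $\gamma(\mathbf{z})=\gamma(|\mathbf{z}|)$. Put $\mathbf{x}_{\mathbf{k}}=h\mathbf{k}$, $W(\mathbf{z})=|\mathbf{z}|^2/|\mathbf{z}|_1$ ($|\cdot|$ Euclidean norm, $|\cdot|_1$ the $\ell^1$ norm), and let $\phi_{\mathbf{k}}$ be the piecewise bilinear basis function on the uniform grid $h\mathbb{Z}^2$ ($\phi_{\mathbf{k}}(\mathbf{x}_{\mathbf{k}})=1$, $\phi_{\mathbf{k}}(\mathbf{x}_{\mathbf{i}})=0$ for $\mathbf{i}\ne\mathbf{k}$). Define $$a_{\mathbf{k}}=\frac{1}{W(\mathbf{x}_{\mathbf{k}})}\int_{\mathcal{H}_{\mathbf 0}}\phi_{\mathbf{k}}(\mathbf{z})W(\mathbf{z})\gamma(\mathbf{z})\,d\mathbf{z}\ (\mathbf{k}\neq\mathbf 0),\qquad a_{\mathbf 0}=-\sum_{\mathbf{k}\ne\mathbf 0}a_{\mathbf{k}},\qquad \mathcal{L}_hu_{\mathbf{i}}=\sum_{\mathbf{k}\in\mathbb{Z}^2}a_{\mathbf{k}}u_{\mathbf{i}+\mathbf{k}}.$$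 That $e^{-\iota\omega t}e^{\iota(\kappa_1^hi_1+\kappa_2^hi_2)h}$ is a fundamental solution means that it solves the discrete wave equation, i.e. $\omega$ and $(\kappa_1^h,\kappa_2^h)$ are linked by the corresponding discrete dispersion relation. Discrete complex domain. For $\alpha=1,2$, $(\sigma_l^\alpha)_{l\in\mathbb{Z}}$ are real numbers (PML absorbing coefficients) with $\sigma_l^\alpha\ge0$ for all $l$ and $\sigma^\alpha_l=0$ for $l<0$. An empty product (for $j_\alpha\le0$) equals $1$. For $i,j\in\mathbb{Z}$ put $z^\alpha_{i,j}=(i+j)h+\iota\frac{h}{\omega}\sum_{l=0}^{j-1}\sigma_l^\alpha$ (the sum is $0$ for $j\le0$), and for $\mathbf i=(i_1,i_2),\mathbf j=(j_1,j_2)\in\mathbb{Z}^2$ put $z^\alpha_{\mathbf i,\mathbf j}=z^\alpha_{i_\alpha,j_\alpha}$. $\Lambda$ denotes the infinite quadrilateral lattice indexed by $\mathbb{Z}^2$. For functions on $\mathbb{Z}^2\times\mathbb{Z}^2$ with indices $(\mathbf i,\mathbf j)$, $\tau^\alpha_k$ replaces $i_\alpha$ by $i_\alpha+k$ and $\rho^\alpha_k$ replaces $j_\alpha$ by $j_\alpha+k$. A function $w:\mathbb{Z}^2\times\mathbb{Z}^2\to\mathbb{C}$ is discrete holomorphic on $(\Lambda,z^\alpha)$ if for all $\mathbf i,\mathbf j\in\mathbb{Z}^2$ $$\frac{\tau_1^\alpha\rho_1^\alpha w_{\mathbf i,\mathbf j}-w_{\mathbf i,\mathbf j}}{\tau_1^\alpha\rho_1^\alpha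 z^\alpha_{\mathbf i,\mathbf j}-z^\alpha_{\mathbf i,\mathbf j}}=\frac{\rho_1^\alpha w_{\mathbf i,\mathbf j}-\tau_1^\alpha w_{\mathbf i,\mathbf j}}{\rho_1^\alpha z^\alpha_{\mathbf i,\mathbf j}-\tau_1^\alpha z^\alpha_{\mathbf i,\mathbf j}}.$$
   Formalization: In the first part the denominators in η are assumed nonzero (they can vanish for κ in K), and discrete holomorphy is stated with denominators cleared, since the second quotient is 0/0 wherever σ vanishes (e.g. for all j_α < 0); there it says ρw = τw. *)

(* Defs.v *)
From HB Require Import structures.
From mathcomp Require Export all_boot all_order all_algebra.
From mathcomp Require Export all_classical all_reals all_analysis.
From mathcomp.real_closed Require Export complex.
From mathcomp Require Import lra zify.

Set Implicit Arguments.
Unset Strict Implicit.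
Unset Printing Implicit Defensive.

Import Order.TTheory GRing.Theory Num.Theory.
Import numFieldNormedType.Exports.

Local Open Scope classical_set_scope.
Local Open Scope ring_scope.
Local Open Scope complex_scope.

Section Complex.
Context {R : realType}.

Definition cexp (z : R[i]) : R[i] :=
  (expR (complex.Re z))%:C
  * (cos (complex.Im z) +i* sin (complex.Im z)).

Definition is_cderive (f : R -> R[i]) (t : R) (l : R[i]) : Prop :=
  is_derive t (1 : R) (fun s : R => complex.Re (f s)) (complex.Re l) /\
  is_derive t (1 : R) (fun s : R => complex.Im (f s)) (complex.Im l).

Definition calK (h : R) : set R[i] :=
  [set k : R[i] | [/\ - (pi / h) < complex.Re k, complex.Re k <= pi / h
                    & complex.Im k < 0]].

End Complex.

(* Z^2 is 'rV[int]_2; the two components of k are k 0 0 and k 0 1, and the two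
   values of the coordinate index alpha are the elements 0 and 1 of 'I_2. *)

Section NonlocalOperator.
Context {R : realType}.

Definition norm2 (z : R * R) : R := Num.sqrt (z.1 ^+ 2 + z.2 ^+ 2).

Definition norm1 (z : R * R) : R := `|z.1| + `|z.2|.

Definition disc (delta : R) : set (R * R) := [set z | norm2 z <= delta].

Definition gridpt (h : R) (k : 'rV[int]_2) : R * R :=
  (h * (k 0 0)%:~R, h * (k 0 1)%:~R).

Definition weight (z : R * R) : R := norm2 z ^+ 2 / norm1 z.

Definition hat (x : R) : R := Num.max 0 (1 - `|x|).

(* The nodal piecewise bilinear function of a uniform rectangular grid is the
   tensor product of the one-dimensional hat functions. *)
Definition basisfun (h : R) (k : 'rV[int]_2) (z : R * R) : R :=
  hat ((z.1 - (gridpt h k).1) / h) * hat ((z.2 - (gridpt h k).2) / h).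

(* [gamma] is the radial profile: the kernel is z |-> gamma (norm2 z). *)
Definition coef_off (h delta : R) (gamma : R -> R) (k : 'rV[int]_2) : R :=
  (weight (gridpt h k))^-1 *
  \int[(lebesgue_measure \x lebesgue_measure)%E]_(z in disc delta)
     (basisfun h k z * weight z * gamma (norm2 z)).

Lemma disc_abs (delta : R) (z : R * R) :
  disc delta z -> `|z.1| <= delta /\ `|z.2| <= delta.
Proof.
rewrite /disc /norm2 /= => zd.
by split; apply: le_trans zd; rewrite -sqrtr_sqr ler_wsqrtr // ?lerDl ?lerDr
  sqr_ge0.
Qed.

Lemma hat_eq0 (h x y : R) : 0 < h -> h <= `|x - y| -> hat ((x - y) / h) = 0.
Proof.
move=> h0 hxy; apply/max_idPl.
by rewrite subr_le0 normrM normfV (gtr0_norm h0) ler_pdivlMr // mul1r.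
Qed.

Lemma coef_off_eq0 (h delta : R) (gamma : R -> R) (k : 'rV[int]_2)
    (a : 'I_2) :
  0 < h -> delta + h <= h * `|(k 0 a)%:~R| -> coef_off h delta gamma k = 0.
Proof.
move=> h0 hk; rewrite /coef_off.
suff -> : \int[(lebesgue_measure \x lebesgue_measure)%E]_(z in disc delta)
    (basisfun h k z * weight z * gamma (norm2 z)) = 0 by rewrite mulr0.
rewrite -[RHS](_ : \int[(lebesgue_measure \x lebesgue_measure)%E]_(z in disc delta)
    (0 : R) = 0); last by rewrite /Rintegral integral0.
apply: eq_Rintegral => z /set_mem /disc_abs [z1 z2].
have far (x : R) : `|x| <= delta -> h <= `|x - h * (k 0 a)%:~R|.
  move=> xd; rewrite distrC.
  have := lerB_dist (h * (k 0 a)%:~R) x; rewrite normrM (gtr0_norm h0); lra.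
rewrite /basisfun /gridpt /=.
have [] : a = 0 \/ a = 1.
  by case: a {hk far} => -[|[|//]] lt; [left|right]; apply/val_inj.
- by move=> a0; rewrite {}a0 in far; rewrite (hat_eq0 h0 (far _ z1)) !mul0r.
- by move=> a1; rewrite {}a1 in far;
    rewrite (hat_eq0 h0 (far _ z2)) mulr0 !mul0r.
Qed.

(* The sums over Z^2 below are sums of finitely supported families. *)
Lemma coef_off_finite (h delta : R) (gamma : R -> R) :
  0 < h -> finite_set [set k | coef_off h delta gamma k != 0].
Proof.
move=> h0; pose N := Num.truncn `|(delta + h) / h|.
pose f (p : nat * nat) : 'rV[int]_2 :=
  \row_a (if a == 0 then p.1%:Z - N%:Z - 1 else p.2%:Z - N%:Z - 1).
apply: (@sub_finite_set _ _ (f @` (`I_(N + N + 3) `*` `I_(N + N + 3)))).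
  move=> k /= k0.
  have bnd (a : 'I_2) : (`|(k 0 a)%R|%N <= N)%N.
    rewrite leqNgt; apply/negP => lt; case/negP: k0; apply/eqP.
    apply: (@coef_off_eq0 _ _ _ _ a) => //.
    have : `|(delta + h) / h| <= `|(k 0 a)%:~R| :> R.
      rewrite -intr_norm -abszE; apply: ltW.
      apply: lt_le_trans (truncnS_gt _) _.
      by rewrite -pmulrn ler_nat.
    move/(le_trans (ler_norm _)); rewrite ler_pdivrMr // => /le_trans; apply.
    by rewrite mulrC.
  exists (`|(k 0 0 + N%:Z + 1)%R|%N, `|(k 0 1 + N%:Z + 1)%R|%N).
    by split => /=; [have := bnd 0|have := bnd 1]; lia.
  apply/rowP => a; rewrite mxE /=.
  have [->|a1] := eqVneq a 0; first by have := bnd 0; lia.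
  have -> : a = 1.
    by case: a a1 => -[|[|//]] lt //= _; apply/val_inj.
  by have := bnd 1; lia.
exact/finite_image/finite_setX.
Qed.

Definition coef (h delta : R) (gamma : R -> R) (k : 'rV[int]_2) : R :=
  if k == 0 then - (\sum_(m \in [set m | m != 0]) coef_off h delta gamma m)
  else coef_off h delta gamma k.

Definition nonlocal_op (h delta : R) (gamma : R -> R)
    (u : 'rV[int]_2 -> R[i]) (i : 'rV[int]_2) : R[i] :=
  \sum_(k \in [set: 'rV[int]_2]) (coef h delta gamma k)%:C * u (i + k).

Definition solves_wave (h delta : R) (gamma : R -> R)
    (v : R -> 'rV[int]_2 -> R[i]) : Prop :=
  exists v' : R -> 'rV[int]_2 -> R[i], forall (t : R) (i : 'rV[int]_2),
    is_cderive (v^~ i) t (v' t i) /\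
    is_cderive (v'^~ i) t (nonlocal_op h delta gamma (v t) i).

Definition plane_wave (h : R) (kappa : 'I_2 -> R[i]) (i : 'rV[int]_2) : R[i] :=
  cexp ('i%C * (kappa 0 * (i 0 0)%:~R + kappa 1 * (i 0 1)%:~R) * h%:C).

Definition time_factor (omega t : R) : R[i] := cexp (- ('i%C * (omega * t)%:C)).

End NonlocalOperator.

Section DiscreteHolomorphy.
Context {R : realType}.

Definition lattice_fun := 'rV[int]_2 -> 'rV[int]_2 -> R[i].

Definition tau (alpha : 'I_2) (k : int) (w : lattice_fun) : lattice_fun :=
  fun i j => w (i + k *: delta_mx 0 alpha) j.

Definition rho (alpha : 'I_2) (k : int) (w : lattice_fun) : lattice_fun :=
  fun i j => w i (j + k *: delta_mx 0 alpha).

(* Equality of the two difference quotients along the diagonals of each cell,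
   with denominators cleared.  Where the absorbing coefficient vanishes the
   vertices rho z and tau z coincide and the second quotient is 0/0; the
   equation then says that w takes the same value at both vertices. *)
Definition discrete_holomorphic (alpha : 'I_2) (z w : lattice_fun) : Prop :=
  forall i j : 'rV[int]_2,
    (tau alpha 1 (rho alpha 1 w) i j - w i j)
    * (rho alpha 1 z i j - tau alpha 1 z i j)
    = (rho alpha 1 w i j - tau alpha 1 w i j)
      * (tau alpha 1 (rho alpha 1 z) i j - z i j).

Lemma discrete_holomorphic_quotient (alpha : 'I_2) (z w : lattice_fun) :
  (forall i j, tau alpha 1 (rho alpha 1 z) i j - z i j != 0) ->
  (forall i j, rho alpha 1 z i j - tau alpha 1 z i j != 0) ->
  discrete_holomorphic alpha z w <->
  forall i j : 'rV[int]_2,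
    (tau alpha 1 (rho alpha 1 w) i j - w i j)
    / (tau alpha 1 (rho alpha 1 z) i j - z i j)
    = (rho alpha 1 w i j - tau alpha 1 w i j)
      / (rho alpha 1 z i j - tau alpha 1 z i j).
Proof.
move=> dz0 dz1; split=> H i j; have {}H := H i j.
  by apply/eqP; rewrite eqr_div ?dz0 ?dz1 // H.
by apply/eqP; rewrite -eqr_div ?dz0 ?dz1 // H.
Qed.

End DiscreteHolomorphy.

Section PML.
Context {R : realType}.

(* The number of factors l = 0, ..., j - 1, which is 0 when j <= 0. *)
Definition npos (j : int) : nat := if j is Posz n then n else 0%N.

Definition zcoord (h omega : R) (sigma : 'I_2 -> int -> R) (alpha : 'I_2)
    (i j : 'rV[int]_2) : R[i] :=
  ((i 0 alpha + j 0 alpha)%:~R * h)%:C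
  + 'i%C * (h / omega * \sum_(l < npos (j 0 alpha)) sigma alpha l%:Z)%:C.

Definition eta_num (h s : R) (kappa : R[i]) (omega : R) : R[i] :=
  2 + 'i%C * (s / omega)%:C * (1 - cexp (- ('i%C * kappa * h%:C))).

Definition eta_den (h s : R) (kappa : R[i]) (omega : R) : R[i] :=
  2 + 'i%C * (s / omega)%:C * (1 - cexp ('i%C * kappa * h%:C)).

Definition eta (h : R) (j : int) (sigma : int -> R) (kappa : R[i])
    (omega : R) : R[i] :=
  \prod_(l < npos j) (eta_num h (sigma l%:Z) kappa omega
                      / eta_den h (sigma l%:Z) kappa omega).

Definition extension (h : R) (sigma : 'I_2 -> int -> R) (kappa : 'I_2 -> R[i])
    (omega : R) (i j : 'rV[int]_2) : R[i] :=
  \prod_(alpha < 2)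
    (eta h (j 0 alpha) (sigma alpha) (kappa alpha) omega
     * cexp ('i%C * kappa alpha * (i 0 alpha + j 0 alpha)%:~R * h%:C)).

End PML.

(* Main.v *)
(** The extension in the index j multiplies the plane wave in i by a constant, so
    it solves the same linear equation.  Within a cell in direction alpha, with
    S = i sigma_l / omega and q = e^{i kappa h}, the discrete Cauchy-Riemann
    equation says that the ratio r of two successive values of eta satisfies
    (r q^2 - 1) S = (r - 1) q (2 + S), whose solution is the factor of eta.  For the
    bound, write q = E (c + i d) with E > 1, c^2 + d^2 = 1 and d >= 0 (as
    0 < Re kappa <= pi / h), and s = sigma_l / omega > 0: the squared modulus of
    the denominator exceeds that of the numerator by
    4 s d (E + 1/E) + s^2 (E - 1/E) (E + 1/E - 2 c) > 0. *)

Require Import Defs.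
From mathcomp Require Import ring lra.

Set Implicit Arguments.
Unset Strict Implicit.
Unset Printing Implicit Defensive.

Import Order.TTheory GRing.Theory Num.Theory.
Import numFieldNormedType.Exports.

Local Open Scope classical_set_scope.
Local Open Scope ring_scope.
Local Open Scope complex_scope.

(** * Multiplicativity of the complex exponential *)

Section Exponential.
Context {R : realType}.
Implicit Types z w : R[i].

Lemma cexp0 : cexp 0 = 1 :> R[i].
Proof. by rewrite /cexp /= expR0 cos0 sin0 mul1r. Qed.

Lemma cexpD z w : cexp (z + w) = cexp z * cexp w.
Proof.
case: z w => [a b] [c d]; apply/eqP; rewrite eq_complex /cexp /= expRD cosD sinD.
by apply/andP; split; apply/eqP; ring.
Qed.

Lemma cexp_neq0 z : cexp z != 0.
Proof.
apply/eqP => z0; have := cexpD z (- z).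
by rewrite subrr cexp0 z0 mul0r => /eqP; rewrite oner_eq0.
Qed.

Lemma cexpN z : cexp (- z) = (cexp z)^-1.
Proof.
by apply: (mulfI (cexp_neq0 z)); rewrite -cexpD subrr cexp0 divff ?cexp_neq0.
Qed.

Lemma cexp_rect (a b : R) :
  cexp (a +i* b) = (expR a * cos b) +i* (expR a * sin b).
Proof. by rewrite /cexp; simpc. Qed.

End Exponential.

(** * Stability of the wave equation and of discrete holomorphy under complex scaling *)

Section WaveEquation.
Context {R : realType}.

Lemma is_cderiveZ (c : R[i]) (f : R -> R[i]) (t : R) (l : R[i]) :
  is_cderive f t l -> is_cderive (fun s => c * f s) t (c * l).
Proof.
case: c l => [a b] [p q] [/= dRe dIm].
have E s : (a +i* b) * f s =
    (a * complex.Re (f s) - b * complex.Im (f s))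
    +i* (a * complex.Im (f s) + b * complex.Re (f s)).
  by case: (f s).
split.
- rewrite (_ : (fun s => _) = (a \*: (fun s => complex.Re (f s)))
                            - (b \*: (fun s => complex.Im (f s)))).
    exact: is_deriveB.
  by apply/funext => s; rewrite E.
- rewrite (_ : (fun s => _) = (a \*: (fun s => complex.Im (f s)))
                            + (b \*: (fun s => complex.Re (f s)))).
    exact: is_deriveD.
  by apply/funext => s; rewrite E.
Qed.

Lemma nonlocal_opZ (h delta : R) (gamma : R -> R) (c : R[i])
    (u : 'rV[int]_2 -> R[i]) (i : 'rV[int]_2) :
  nonlocal_op h delta gamma (fun k => c * u k) i =
  c * nonlocal_op h delta gamma u i.
Proof.
rewrite /nonlocal_op mulr_fsumr.
by apply: eq_fsbigr => k _; rewrite mulrCA.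
Qed.

Lemma solves_waveZ (h delta : R) (gamma : R -> R) (c : R[i])
    (v : R -> 'rV[int]_2 -> R[i]) :
  solves_wave h delta gamma v ->
  solves_wave h delta gamma (fun t i => c * v t i).
Proof.
move=> [v' vv']; exists (fun t i => c * v' t i) => t i.
have [v1 v2] := vv' t i; split; first exact: is_cderiveZ.
by rewrite nonlocal_opZ; exact: is_cderiveZ.
Qed.

End WaveEquation.

(** The cell equation is linear in [w]; at a fixed time this lets [time_factor] be absorbed as the
    constant. *)
Lemma discrete_holomorphicZ (R : realType) (alpha : 'I_2)
    (z w : @lattice_fun R) (c : R[i]) :
  discrete_holomorphic alpha z w ->
  discrete_holomorphic alpha z (fun i j => c * w i j).
Proof.
move=> zw i j; have := zw i j; rewrite /tau /rho => zwij.
by rewrite -!mulrBr -[LHS]mulrA zwij mulrA.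
Qed.

(** * The extension on the four vertices of a cell *)

Section Extension.
Context {R : realType} (h omega : R).
Context (sigma : 'I_2 -> int -> R) (kappa : 'I_2 -> R[i]).

(** The exponent is additive in [i] and [j], and [eta] sees only [j], so the two indices
    separate. *)
Lemma extension_plane_wave (i j : 'rV[int]_2) :
  extension h sigma kappa omega i j =
  extension h sigma kappa omega 0 j * plane_wave h kappa i.
Proof.
have -> : plane_wave h kappa i =
    \prod_(alpha < 2) cexp ('i%C * kappa alpha * (i 0 alpha)%:~R * h%:C).
  rewrite /plane_wave !big_ord_recl big_ord0 mulr1 -cexpD.
  have -> : lift ord0 ord0 = 1 :> 'I_2 by apply/val_inj.
  by congr cexp; ring.
rewrite /extension -big_split /=; apply: eq_bigr => alpha _.
by rewrite mxE add0r -[RHS]mulrA -cexpD rmorphD /=; congr (_ * cexp _); ring.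
Qed.

Lemma extension0 (i : 'rV[int]_2) :
  extension h sigma kappa omega i 0 = plane_wave h kappa i.
Proof.
rewrite extension_plane_wave -[RHS]mul1r; congr (_ * _).
apply: big1 => alpha _.
by rewrite !mxE addr0 mulr0 mul0r cexp0 /eta /= big_ord0 mulr1.
Qed.

(** Both products are empty, including the borderline case [j = -1], where [j + 1 = 0]. *)
Lemma eta_neg (j : int) (s : int -> R) (k : R[i]) :
  j < 0 -> eta h (j + 1) s k omega = eta h j s k omega.
Proof. by case: j => // -[|n] _; rewrite /eta /= !big_ord0. Qed.

Lemma eta_succ (n : nat) (s : int -> R) (k : R[i]) :
  eta h (n%:Z + 1) s k omega =
  eta h n%:Z s k omega
  * (eta_num h (s n%:Z) k omega / eta_den h (s n%:Z) k omega).
Proof. by rewrite /eta -PoszD addn1 /= big_ord_recr. Qed.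

Lemma zcoord_tau (alpha : 'I_2) (i j : 'rV[int]_2) :
  tau alpha 1 (zcoord h omega sigma alpha) i j =
  zcoord h omega sigma alpha i j + h%:C.
Proof.
rewrite /tau /zcoord !mxE !eqxx mulr1 addrAC (intrD _ _ 1) mulrDl mul1r rmorphD /=.
by rewrite addrAC.
Qed.

Lemma zcoord_rho_neg (alpha : 'I_2) (i j : 'rV[int]_2) : j 0 alpha < 0 ->
  rho alpha 1 (zcoord h omega sigma alpha) i j =
  tau alpha 1 (zcoord h omega sigma alpha) i j.
Proof.
rewrite /rho /tau /zcoord !mxE !eqxx mulr1 addrA [in LHS]addrAC => j0.
rewrite addrAC; congr (_ + _); congr (_ * (_ * _)%:C).
by case: (j 0 alpha) j0 => // -[|n] _; rewrite /= big_ord0.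
Qed.

Lemma zcoord_rho (alpha : 'I_2) (i j : 'rV[int]_2) (n : nat) :
  j 0 alpha = n%:Z ->
  rho alpha 1 (zcoord h omega sigma alpha) i j =
  tau alpha 1 (zcoord h omega sigma alpha) i j
  + h%:C * ('i%C * (sigma alpha n%:Z / omega)%:C).
Proof.
move=> jn; rewrite /rho /tau /zcoord !mxE !eqxx mulr1 jn addrA addrAC.
rewrite -PoszD [(n + 1)%N]addn1 /= big_ord_recr /= mulrDr.
rewrite !(rmorphD, rmorphM) /=.
by ring.
Qed.

(** The factor of the other direction, which is common to all four vertices of a cell in direction
    [alpha]. *)
Definition cofactor_ext (alpha : 'I_2) (i j : 'rV[int]_2) : R[i] :=
  \prod_(beta < 2 | beta != alpha)
    (eta h (j 0 beta) (sigma beta) (kappa beta) omega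
     * cexp ('i%C * kappa beta * (i 0 beta + j 0 beta)%:~R * h%:C)).

(** The choices of [m] and [n] in {0, 1} give the values at all four vertices of a cell. *)
Lemma extension_shift (alpha : 'I_2) (m n : int) (i j : 'rV[int]_2) :
  extension h sigma kappa omega
    (i + m *: delta_mx 0 alpha) (j + n *: delta_mx 0 alpha) =
  eta h (j 0 alpha + n) (sigma alpha) (kappa alpha) omega
  * cexp ('i%C * kappa alpha * (i 0 alpha + j 0 alpha + (m + n))%:~R * h%:C)
  * cofactor_ext alpha i j.
Proof.
rewrite /extension (bigD1 alpha) //= !mxE !eqxx !mulr1 addrACA.
congr (_ * _); apply: eq_bigr => beta ba.
by rewrite !mxE (negbTE ba) andbF !mulr0 !addr0.
Qed.

(** Relating [b] to [n] by an equation lets the integer literals 1 and 2 be matched by [erefl]. *)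
Lemma cexp_shift (k : R[i]) (a b : int) (n : nat) : b = n%:Z ->
  cexp ('i%C * k * (a + b)%:~R * h%:C) =
  cexp ('i%C * k * a%:~R * h%:C) * cexp ('i%C * k * h%:C) ^+ n.
Proof.
move=> ->; elim: n => [|n IHn]; first by rewrite addr0 expr0 mulr1.
rewrite exprSr mulrA -IHn -cexpD; congr cexp.
by rewrite -[n.+1]addn1 PoszD addrA (intrD _ (a + n%:Z)) /=; ring.
Qed.

(* [N / D] is the factor of [eta]; [S = i sigma / omega], [q = e^{i kappa h}]. *)
Lemma cell_identity (S q N D : R[i]) :
  q != 0 -> N = 2 + S * (1 - q^-1) -> D = 2 + S * (1 - q) ->
  (N * q ^+ 2 - D) * S = (N - D) * q * (2 + S).
Proof. by move=> q0 -> ->; field. Qed.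

Lemma extension_holomorphic (alpha : 'I_2) :
  (forall l : int, eta_den h (sigma alpha l) (kappa alpha) omega != 0) ->
  discrete_holomorphic alpha (zcoord h omega sigma alpha)
    (extension h sigma kappa omega).
Proof.
move=> den0 i j.
have shift m n := @extension_shift alpha m n i j.
have -> : tau alpha 1 (rho alpha 1 (zcoord h omega sigma alpha)) i j =
          rho alpha 1 (zcoord h omega sigma alpha) i j + h%:C.
  exact: zcoord_tau.
have Ew : extension h sigma kappa omega i j =
    eta h (j 0 alpha) (sigma alpha) (kappa alpha) omega
    * cexp ('i%C * kappa alpha * (i 0 alpha + j 0 alpha)%:~R * h%:C)
    * cofactor_ext alpha i j.
  by have := shift 0 0; rewrite !scale0r !addr0.
have Erho : rho alpha 1 (extension h sigma kappa omega) i j =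
    eta h (j 0 alpha + 1) (sigma alpha) (kappa alpha) omega
    * cexp ('i%C * kappa alpha * (i 0 alpha + j 0 alpha + 1)%:~R * h%:C)
    * cofactor_ext alpha i j.
  by have := shift 0 1; rewrite !scale0r !addr0 add0r.
have Etau : tau alpha 1 (extension h sigma kappa omega) i j =
    eta h (j 0 alpha) (sigma alpha) (kappa alpha) omega
    * cexp ('i%C * kappa alpha * (i 0 alpha + j 0 alpha + 1)%:~R * h%:C)
    * cofactor_ext alpha i j.
  by have := shift 1 0; rewrite !scale0r !addr0.
have Ediag : tau alpha 1 (rho alpha 1 (extension h sigma kappa omega)) i j =
    eta h (j 0 alpha + 1) (sigma alpha) (kappa alpha) omega
    * cexp ('i%C * kappa alpha * (i 0 alpha + j 0 alpha + 2)%:~R * h%:C)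
    * cofactor_ext alpha i j.
  exact: (shift 1 1).
rewrite Ediag Erho Etau Ew.
(* Outside the absorbing layer the vertices [rho] and [tau] coincide, and so do the values of the
   extension there; both sides are 0. *)
have [j0|] := ltP (j 0 alpha) 0.
  by rewrite zcoord_rho_neg // eta_neg // subrr mulr0 subrr mul0r.
case jn: (j 0 alpha) => [n|//] _.
rewrite (zcoord_rho _ jn) zcoord_tau eta_succ.
rewrite (@cexp_shift _ _ 1 1%N erefl) (@cexp_shift _ _ 2 2%N erefl).
set N := eta_num _ _ _ _; set D := eta_den _ _ _ _; set e := eta _ _ _ _ _.
set q := cexp ('i%C * _ * h%:C); set S := 'i%C * _%:C.
set Q := cexp _; set C := cofactor_ext _ _ _; set z := zcoord _ _ _ _ _ _.
have D0 : D != 0 := den0 _.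
have cell : (N * q ^+ 2 - D) * S = (N - D) * q * (2 + S).
  by apply: cell_identity; rewrite ?cexp_neq0 // -cexpN.
(* The side vertices differ by [h S]; pulling out the common factor leaves the left side of
   [cell]. *)
have -> : (e * (N / D) * (Q * q ^+ 2) * C - e * Q * C)
    * (z + h%:C + h%:C * S - (z + h%:C)) =
    e / D * Q * C * h%:C * ((N * q ^+ 2 - D) * S) by field.
(* The diagonal increment of [z] is [h (2 + S)], which matches the right side of [cell]. *)
by rewrite cell expr1; field.
Qed.

End Extension.

(** * The strict bound on the factors of [eta] *)

Section Modulus.
Context {R : realType}.

(* The two sides are [|eta_num|^2] and [|eta_den|^2] for
   [e^{i kappa h} = E (c + i d)] and [s = sigma / omega]. *)
Lemma eta_sqnorm_lt (s E c d : R) :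
  0 < s -> 1 < E -> 0 <= d -> c ^+ 2 + d ^+ 2 = 1 ->
  (2 - s * (E^-1 * d)) ^+ 2 + (s * (1 - E^-1 * c)) ^+ 2 <
  (2 + s * (E * d)) ^+ 2 + (s * (1 - E * c)) ^+ 2.
Proof.
move=> s0 E1 d0 cd.
have E0 : 0 < E by lra.
have c1 : c <= 1 by nra.
rewrite -subr_gt0.
(* Keeping [c ^+ 2 + d ^+ 2] unevaluated makes this a pure field identity; the circle relation is
   substituted afterwards. *)
have -> : (2 + s * (E * d)) ^+ 2 + (s * (1 - E * c)) ^+ 2
    - ((2 - s * (E^-1 * d)) ^+ 2 + (s * (1 - E^-1 * c)) ^+ 2) =
    4 * s * d * (E + E^-1)
    + s ^+ 2 * ((E - E^-1) * ((E + E^-1) * (c ^+ 2 + d ^+ 2) - 2 * c)).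
  by field; rewrite gt_eqF.
rewrite cd mulr1.
have V0 : 0 < E^-1 by rewrite invr_gt0.
have VE : E * E^-1 = 1 by rewrite divff // gt_eqF.
have V1 : E^-1 < 1 by rewrite invf_lt1.
apply: ltr_wpDl; first by rewrite !mulr_ge0 // ltW // addr_gt0.
rewrite mulr_gt0 ?exprn_gt0 // mulr_gt0 //; first by lra.
(* Here [E + 1/E - 2 = (E - 1) (1 - 1/E) > 0], while [2 c <= 2]. *)
by nra.
Qed.

Lemma eta_num_lt_den (h omega s : R) (k : R[i]) : 0 < h -> calK h k ->
  0 < omega -> 0 < s -> 0 < complex.Re k ->
  `|eta_num h s k omega| < `|eta_den h s k omega|.
Proof.
case: k => [a b] h0 [/= _ ah b0] om0 s0 a0.
(* The modulus of [e^{i kappa h}] exceeds 1 because [Im kappa < 0]; its argument [a h] lies in (0,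
   pi], whence the sign of the sine. *)
have E1 : 1 < expR (- (b * h)) by rewrite expR_gt1; nra.
have d0 : 0 <= sin (a * h).
  by apply: sin_ge0_pi; rewrite -ler_pdivlMr // ah mulr_ge0 ?ltW.
have so : 0 < s / omega by rewrite divr_gt0.
have := eta_sqnorm_lt so E1 d0 (cos2Dsin2 _).
have kE : 'i%C * (a +i* b) * h%:C = (- (b * h)) +i* (a * h).
  by apply/eqP; rewrite eq_complex /=; apply/andP; split; apply/eqP; ring.
have two : 2 = 2 +i* 0 :> R[i] by rewrite -[RHS]/(2%:C) rmorph_nat.
rewrite /eta_num /eta_den kE.
have -> : - ((- (b * h)) +i* (a * h)) = (b * h) +i* (- (a * h)).
  by apply/eqP; rewrite eq_complex /= opprK !eqxx.
rewrite !cexp_rect expRN invrK cosN sinN two => lt.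
rewrite !normc_def ltcR ltr_sqrt.
  by apply: le_lt_trans (lt_le_trans lt _); rewrite le_eqVlt; apply/orP; left;
    apply/eqP => /=; ring.
(* [ltr_sqrt] also asks for a positive right radicand: it strictly exceeds a sum of squares. *)
apply: le_lt_trans (lt_le_trans lt _).
  by rewrite addr_ge0 ?sqr_ge0.
by rewrite le_eqVlt; apply/orP; left; apply/eqP => /=; ring.
Qed.

End Modulus.

Theorem lemma3p1 (R : realType) (h delta : R) (gamma : R -> R) (omega : R)
    (kappa : 'I_2 -> R[i]) (sigma : 'I_2 -> int -> R)
    (h_gt0 : 0 < h) (delta_gt0 : 0 < delta)
    (gamma_ge0 : forall r : R, 0 <= r -> 0 <= gamma r)
    (omega_neq0 : omega != 0)
    (kappaK : forall alpha : 'I_2, calK h (kappa alpha))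
    (sigma_ge0 : forall (alpha : 'I_2) (l : int), 0 <= sigma alpha l)
    (sigma_neg : forall (alpha : 'I_2) (l : int), l < 0 -> sigma alpha l = 0) :
  (* the plane wave is a solution, and all the quotients in eta make sense *)
  (solves_wave h delta gamma
     (fun t i => time_factor omega t * plane_wave h kappa i) ->
   (forall (alpha : 'I_2) (l : int),
      eta_den h (sigma alpha l) (kappa alpha) omega != 0) ->
   [/\ forall i : 'rV[int]_2,
         extension h sigma kappa omega i 0 = plane_wave h kappa i,
       forall (alpha : 'I_2) (t : R),
         discrete_holomorphic alpha (zcoord h omega sigma alpha)
           (fun i j => time_factor omega t * extension h sigma kappa omega i j)
     & forall j : 'rV[int]_2,
         solves_wave h delta gamma
           (fun t i =>
              time_factor omega t * extension h sigma kappa omega i j)]) /\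
  (forall (alpha : 'I_2) (l : int),
     0 < omega -> 0 < sigma alpha l ->
     0 < Num.sg omega * complex.Re (kappa alpha) ->
     eta_den h (sigma alpha l) (kappa alpha) omega != 0 /\
     `|eta_num h (sigma alpha l) (kappa alpha) omega
       / eta_den h (sigma alpha l) (kappa alpha) omega| < 1).
Proof.
split.
  move=> wave den0; split; first exact: extension0.
  - move=> alpha t.
    exact: (discrete_holomorphicZ _ (extension_holomorphic (den0 alpha))).
  (* For fixed [j] the scaling constant is the value of the extension at [i = 0]. *)
  - move=> j; have := solves_waveZ (extension h sigma kappa omega 0 j) wave.
    congr (solves_wave _ _ _ _).
    apply/funext => t; apply/funext => i.
    by rewrite mulrCA -extension_plane_wave.
move=> alpha l om0 s0; rewrite gtr0_sg // mul1r => k0.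
have lt := eta_num_lt_den h_gt0 (kappaK alpha) om0 s0 k0.
(* Strictness of the bound also shows that the denominator is nonzero. *)
have D0 := le_lt_trans (normr_ge0 _) lt.
by rewrite -normr_gt0 D0 normf_div ltr_pdivrMr // mul1r.
Qed.
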